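(* Let $n$ be a positive integer and $k,l$ integers with $(n,k,l)=1$, and suppose that condition (C) holds: $3l\equiv 0\bmod n$ or $3k\equiv 0\bmod n$ or $3(l-k)\equiv 0\bmod n$. Let (A) denote the condition: $n\equiv 0\bmod 3$ and $k+l\equiv 0\bmod 3$. Let $G=G_n(x_0x_kx_l)$. Then \[G\cong\begin{cases}B\left(\frac{2^n-(-1)^n}{3},\,3,\,2^{2n/3},\,1\right)&\text{if (A) does not hold and } k\not\equiv 0,\ l\not\equiv 0,\ k\not\equiv l,\\ \mathbb{Z}_{2^n-(-1)^n}&\text{if } k\equiv 0,\text{ or } l\equiv 0,\text{ or } k\equiv l,\\ \mathbb{Z}_{(2^{n/3}-(-1)^{n/3})/3}*\mathbb{Z}*\mathbb{Z}&\text{if (A) holds,}\end{cases}\] where the congruences between $k$, $l$ and $0$ in the case conditions are modulo $n$.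
   Context: $(a,b,\dots)$ denotes the greatest common divisor; $\mathbb{Z}_m$ is the cyclic group of order $m$; $*$ denotes free product. For a word $w$ in $x_0,\dots,x_{n-1}$, $G_n(w)=\langle x_0,\dots,x_{n-1}\mid w,\theta(w),\dots,\theta^{n-1}(w)\rangle$ where $\theta(x_i)=x_{i+1}$, subscripts modulo $n$; thus $G_n(x_0x_kx_l)=\langle x_0,\dots,x_{n-1}\mid x_ix_{i+k}x_{i+l}\ (0\le i<n)\rangle$. For integers $M,N,R,\lambda$ with $R^N\equiv 1\bmod M$, $B(M,N,R,\lambda)=\langle a,b\mid a^M=1,\ bab^{-1}=a^R,\ b^N=a^{\lambda M/(M,R-1)}\rangle$. *)

(* Defs.v *)
From HB Require Import structures.
From mathcomp Require Import all_boot all_order all_algebra.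
From mathcomp Require Import boolp.

Set Implicit Arguments.
Unset Strict Implicit.
Unset Printing Implicit Defensive.

Import GRing.Theory.
Local Open Scope quotient_scope.
Local Open Scope group_scope.

Definition isomorphic (G H : groupType) : Prop :=
  exists f : {multiplicative G -> H}, bijective f.

(* The letter (x, false) stands for x and (x, true) for x^-1. *)
Definition word (X : Type) : Type := seq (X * bool).

Section Words.
Variable X : Type.

Definition letter_inv (a : X * bool) : X * bool := (a.1, ~~ a.2).

Definition word_inv (w : word X) : word X := rev (map letter_inv w).

Definition word_pow (x : X) (z : int) : word X := nseq `|z|%N (x, (z < 0)%R).

(* [R u v] is the defining relation u = v; [word_eq R] is the congruence it
   generates, so that words modulo [word_eq R] form the quotient of the free
   group on X by the normal closure of the elements u v^-1 with R u v. *)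
Inductive word_eq (R : word X -> word X -> Prop) : word X -> word X -> Prop :=
| word_eq_rel u v : R u v -> word_eq R u v
| word_eq_cancel a : word_eq R [:: a; letter_inv a] [::]
| word_eq_cat u u' v v' :
    word_eq R u u' -> word_eq R v v' -> word_eq R (u ++ v) (u' ++ v')
| word_eq_refl u : word_eq R u u
| word_eq_sym u v : word_eq R u v -> word_eq R v u
| word_eq_trans u v w : word_eq R u v -> word_eq R v w -> word_eq R u w.

Lemma letter_invK : involutive letter_inv.
Proof. by case=> x b; rewrite /letter_inv /= negbK. Qed.

Lemma word_invK : involutive word_inv.
Proof.
by move=> w; rewrite /word_inv map_rev revK; exact: mapK letter_invK w.
Qed.

Lemma word_inv_cat u v : word_inv (u ++ v) = word_inv v ++ word_inv u.
Proof. by rewrite /word_inv map_cat rev_cat. Qed.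

Lemma word_eq_catV R w : word_eq R (w ++ word_inv w) [::].
Proof.
elim: w => [|a w IHw]; first exact: word_eq_refl.
rewrite -cat1s word_inv_cat catA -(catA [:: a]).
apply: word_eq_trans (word_eq_cancel R a).
apply: (@word_eq_cat _ _ [:: a] _ [:: letter_inv a]) (word_eq_refl _ _).
rewrite -[X in word_eq _ _ X]cats0.
exact: word_eq_cat (word_eq_refl _ _) IHw.
Qed.

Lemma word_eq_Vcat R w : word_eq R (word_inv w ++ w) [::].
Proof. by rewrite -{2}(word_invK w); exact: word_eq_catV. Qed.

Lemma word_eq_inv R u v : word_eq R u v -> word_eq R (word_inv u) (word_inv v).
Proof.
move=> uv; apply: (@word_eq_trans _ _ (word_inv u ++ (v ++ word_inv v))).
  rewrite -[X in word_eq _ X]cats0.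
  exact: word_eq_cat (word_eq_refl _ _) (word_eq_sym (word_eq_catV _ _)).
rewrite catA -[X in word_eq _ _ X]cat0s.
apply: word_eq_cat (word_eq_refl _ _).
apply: word_eq_trans (word_eq_Vcat _ u).
exact: word_eq_cat (word_eq_refl _ _) (word_eq_sym uv).
Qed.

End Words.

Section Presentation.
Variables (X : choiceType) (R : word X -> word X -> Prop).

Definition word_eqb (u v : word X) : bool := `[< word_eq R u v >].

Lemma word_eqb_refl : reflexive word_eqb.
Proof. by move=> u; apply/asboolP; exact: word_eq_refl. Qed.

Lemma word_eqb_sym : symmetric word_eqb.
Proof. by move=> u v; apply/asboolP/asboolP; exact: word_eq_sym. Qed.

Lemma word_eqb_trans : transitive word_eqb.
Proof.
by move=> v u w /asboolP uv /asboolP vw; apply/asboolP; exact: word_eq_trans vw.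
Qed.

Canonical word_equiv : equiv_rel (word X) :=
  EquivRel word_eqb word_eqb_refl word_eqb_sym word_eqb_trans.

(* < X | R > *)
Definition presented : Type := {eq_quot word_equiv}.

HB.instance Definition _ := Choice.on presented.

Definition pres_class (w : word X) : presented := \pi_({eq_quot word_equiv}) w.

Definition pres_word (g : presented) : word X := @repr _ {eq_quot word_equiv} g.

Lemma pres_wordK : cancel pres_word pres_class.
Proof. exact: reprK. Qed.

Lemma pres_classP u v : pres_class u = pres_class v <-> word_eq R u v.
Proof.
split; first by move/eqP; rewrite (eqmodE word_equiv) => /asboolP.
by move=> uv; apply/eqP; rewrite (eqmodE word_equiv); apply/asboolP.
Qed.

Lemma pres_classK w : word_eq R (pres_word (pres_class w)) w.
Proof. by apply/pres_classP; rewrite pres_wordK. Qed.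

Definition pres_mul (g h : presented) : presented :=
  pres_class (pres_word g ++ pres_word h).
Definition pres_inv (g : presented) : presented :=
  pres_class (word_inv (pres_word g)).
Definition pres_one : presented := pres_class [::].

Lemma pres_mulE u v : pres_mul (pres_class u) (pres_class v) = pres_class (u ++ v).
Proof. by apply/pres_classP; exact: word_eq_cat (pres_classK _) (pres_classK _). Qed.

Lemma pres_invE u : pres_inv (pres_class u) = pres_class (word_inv u).
Proof. by apply/pres_classP; exact: word_eq_inv (pres_classK _). Qed.

Lemma pres_mulA : associative pres_mul.
Proof.
move=> g h k; rewrite -(pres_wordK g) -(pres_wordK h) -(pres_wordK k).
by rewrite !pres_mulE catA.
Qed.

Lemma pres_mul1g : left_id pres_one pres_mul.
Proof. by move=> g; rewrite -(pres_wordK g) pres_mulE. Qed.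

Lemma pres_mulg1 : right_id pres_one pres_mul.
Proof. by move=> g; rewrite -(pres_wordK g) pres_mulE cats0. Qed.

Lemma pres_mulVg : left_inverse pres_one pres_inv pres_mul.
Proof.
move=> g; rewrite -(pres_wordK g) pres_invE pres_mulE.
by apply/pres_classP; exact: word_eq_Vcat.
Qed.

Lemma pres_mulgV : right_inverse pres_one pres_inv pres_mul.
Proof.
move=> g; rewrite -(pres_wordK g) pres_invE pres_mulE.
by apply/pres_classP; exact: word_eq_catV.
Qed.

HB.instance Definition _ := isGroup.Build presented
  pres_mulA pres_mul1g pres_mulg1 pres_mulVg pres_mulgV.

End Presentation.

Definition Zgroup : groupType := Algebra.to_multiplicative int.

(* The cyclic group of order m, for m > 0; ['Z_m] would be wrong for m = 1. *)
Definition Zmod (m : nat) : groupType := Algebra.to_multiplicative 'I_m.-1.+1.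

(* G * H as the group generated by the elements of both factors, subject to
   their multiplication tables. *)
Inductive free_product_rel (G H : groupType) :
  word (G + H)%type -> word (G + H)%type -> Prop :=
| free_product_rel_l (x y : G) : free_product_rel
    [:: (inl x, false); (inl y, false)] [:: (inl (x * y), false)]
| free_product_rel_r (x y : H) : free_product_rel
    [:: (inr x, false); (inr y, false)] [:: (inr (x * y), false)].

Definition free_product (G H : groupType) : groupType :=
  presented (@free_product_rel G H).

Definition word_shift (n : nat) (w : word 'I_n) : word 'I_n :=
  [seq (ordS a.1, a.2) | a <- w].

Inductive cyc_pres_rel (n : nat) (w : word 'I_n) : word 'I_n -> word 'I_n -> Prop :=
| CycPresRel j : j < n -> cyc_pres_rel w (iter j (@word_shift n) w) [::].

(* G_n(w) *)
Definition cyc_pres (n : nat) (w : word 'I_n) : groupType :=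
  presented (cyc_pres_rel w).

Lemma modz_lt_nat (n : nat) (k : int) : 0 < n -> `|(k %% n)%Z|%N < n.
Proof.
move=> n_gt0; have n0 : (n%:Z != 0)%R by rewrite eqz_nat -lt0n.
by rewrite -ltz_nat gez0_abs ?modz_ge0 // ltz_pmod.
Qed.

(* The subscript k read modulo n. *)
Definition subscript (n : nat) (n_gt0 : 0 < n) (k : int) : 'I_n :=
  Ordinal (modz_lt_nat k n_gt0).

(* x_0 x_k x_l *)
Definition word3 (n : nat) (n_gt0 : 0 < n) (k l : int) : word 'I_n :=
  [seq (subscript n_gt0 i, false) | i <- [:: 0%R; k; l]].

(* The generator a is [false] and the generator b is [true]. *)
Inductive metacyclic_rel (M N R lambda : int) : word bool -> word bool -> Prop :=
| metacyclic_rel_a :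
    metacyclic_rel M N R lambda (word_pow false M) [::]
| metacyclic_rel_conj :
    metacyclic_rel M N R lambda
      [:: (true, false); (false, false); (true, true)] (word_pow false R)
| metacyclic_rel_b :
    metacyclic_rel M N R lambda (word_pow true N)
      (word_pow false ((lambda * M)%R %/ gcdz M (R - 1)%R)%Z).

(* Meant for R ^ N = 1 modulo M; the presentation makes sense regardless. *)
Definition Bgroup (M N R lambda : int) : groupType :=
  presented (metacyclic_rel M N R lambda).

(* Main.v *)
From HB Require Import structures.
Require Import Defs.
From mathcomp Require Import all_boot all_order all_algebra.
From mathcomp Require Import ring zify.

Set Implicit Arguments.
Unset Strict Implicit.
Unset Printing Implicit Defensive.

Import Order.TTheory GRing.Theory Num.Theory.
Local Open Scope ring_scope.

(** Write the relators as x_i x_(i+k) x_(i+l), with subscripts modulo n.  Three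
    operations change (k, l) but neither the group nor the hypotheses: rotating
    every relator replaces (k, l) by (l - k, -k), inverting every generator
    replaces it by (l, k), and multiplying all subscripts by a unit u modulo n
    replaces it by (u k, u l).  The first two permute the alternatives of
    condition (C), and also the alternatives k = 0, l = 0, k = l; so 3k = 0
    modulo n may be assumed, and k = 0 in the cyclic case.

    When k = 0, scaling makes l = 1; the relators read x_(i+1) = x_i^-2, so the
    group is cyclic, and x_n = x_0 fixes its order 2^n - (-1)^n.

    When 3k = 0, put p_i = x_i x_(i+k) x_(i+2k).  The relators give
      p_(i+k) = x_i^-1 p_i x_i,  x_(i+k+l) = p_i^-1 x_i,  p_(i+k+l) = p_i^-2
    ([triple_conj], [cyc_step], [triple_step]), hence, with
    g_j = 1 + (-2) + ... + (-2)^(j-1) = (1 - (-2)^j) / 3 ([geom]),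
      x_(i+j(k+l)) = p_i^(-g_j) x_i  and  p_(i+j(k+l)) = p_i^((-2)^j).
    If moreover k is nonzero, then 3 divides n; let n = 3m, so that m divides k.
    Everything depends on whether k + l is a unit modulo n.

    If (A) fails, it is, and (k, l) can be brought to (m, 1 - m).  Then
    x_j = p^(-g_j) x with p = p_0 and x = x_0.  The period gives p^(g_n) = 1,
    where g_n = +-M; comparing the two expressions of p_m shows that x conjugates
    p to p^R with R = 4^m; and the definition of p becomes x^3 = p^T with
    T = (z^2 + z + 1) / 3 and z = (-2)^m.  Since (M, R - 1) = |1 - z| and
    M = |1 - z| T ([metacyclic_exponents]), these are the relations of B, with
    a = p and b = x.

    If (A) holds, l is a unit and can be scaled to 1, and k + l is 0 modulo 3
    and 1 modulo m.  The subscripts then fall into three classes modulo 3: two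
    of them are p^(-g_j) x_0 and x_(2k) p^(-g_j), and the relators express the
    third through these.  What remains is p^(g_m) = 1, so p generates the finite
    cyclic factor while x_0 and x_(2k) are free.

    Conversely, each of these formulas for x_j defines a family in the target
    group; that it satisfies the relators is a polynomial identity between
    exponents, because (-2)^j = 1 - 3 g_j.  The two resulting homomorphisms are
    inverse to each other on generators ([isomorphic_cyc]). *)

(** * Homomorphisms and integer powers *)

Local Notation hom := UMagmaMorphism.type.

Lemma isomorphic_can (G H : groupType) (f : hom G H) (g : hom H G) :
  cancel f g -> cancel g f -> isomorphic G H.
Proof. by move=> fK gK; exists f; exists g. Qed.

Lemma morph1 (G H : groupType) (f : G -> H) :
  {morph f : x y / (x * y)%g} -> f 1%g = 1%g.
Proof. by move=> fM; apply: (@mulgI _ (f 1%g)); rewrite -fM !mulg1. Qed.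

Definition hom_of (G H : groupType) (f : G -> H)
    (fM : {morph f : x y / (x * y)%g}) : hom G H :=
  HB.pack f (isUMagmaMorphism.Build G H f (morph1 fM, fM)).

Lemma PoszS1 (n : nat) : n.+1%:Z = n%:Z + 1.
Proof. by rewrite intS addrC. Qed.

Lemma OppzS1 (n : nat) : - n.+1%:Z = - n%:Z - 1.
Proof. by rewrite PoszS1 opprD. Qed.

Section IntegerPowers.
Variable G : groupType.
Implicit Types (x y : G) (i j : int).

Definition expgz x i : G :=
  match i with Posz n => (x ^+ n)%g | Negz n => (x ^- n.+1)%g end.

Lemma expgz0 x : expgz x 0 = 1%g.
Proof. by []. Qed.

Lemma expgz1 x : expgz x 1 = x.
Proof. exact: expg1. Qed.

Lemma expgzS x i : expgz x (i + 1) = (expgz x i * x)%g.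
Proof.
case: i => n; first by rewrite -PoszS1 /= expgSr.
have ->: Negz n + 1 = - n%:Z by rewrite NegzE; lia.
case: n => [|n] /=; first by rewrite expg1 mulVg.
by rewrite [X in (_ = X^-1 * _)%g]expgS invgM mulgVK.
Qed.

Lemma expgzB1 x i : expgz x (i - 1) = (expgz x i * x^-1)%g.
Proof. by rewrite -{2}(subrK 1 i) expgzS mulgK. Qed.

Lemma expgzD x i j : expgz x (i + j) = (expgz x i * expgz x j)%g.
Proof.
elim/int_rect: j => [|n IHn|n IHn]; first by rewrite addr0 mulg1.
  by rewrite PoszS1 addrA !expgzS IHn mulgA.
by rewrite OppzS1 addrA !expgzB1 IHn mulgA.
Qed.

Lemma expgzN x i : expgz x (- i) = ((expgz x i)^-1)%g.
Proof. by apply/esym/mulg1_eq; rewrite -expgzD addrN. Qed.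

Lemma expgzM x i j : expgz x (i * j) = expgz (expgz x i) j.
Proof.
elim/int_rect: j => [|n IHn|n IHn]; first by rewrite mulr0.
  by rewrite PoszS1 mulrDr mulr1 expgzS -IHn expgzD.
by rewrite OppzS1 mulrBr mulr1 expgzB1 -expgzN -IHn expgzD.
Qed.

Lemma expgzJ x y i : (y * expgz x i * y^-1)%g = expgz (y * x * y^-1)%g i.
Proof.
elim/int_rect: i => [|n IHn|n IHn]; first by rewrite mulg1 mulgV.
  by rewrite PoszS1 !expgzS -IHn !mulgA mulgVK.
by rewrite OppzS1 !expgzB1 -IHn !invgM invgK !mulgA mulgVK.
Qed.

Lemma expgz_dvd x (M : int) i : expgz x M = 1%g -> (M %| i)%Z -> expgz x i = 1%g.
Proof.
move=> xM /dvdzP[q ->]; rewrite mulrC expgzM xM.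
by case: q => n /=; rewrite expg1n ?invg1.
Qed.

Lemma expgz_mod x (M : int) i j :
  expgz x M = 1%g -> (M %| i - j)%Z -> expgz x i = expgz x j.
Proof. by move=> xM Mij; rewrite -(subrK j i) expgzD (expgz_dvd xM Mij) mul1g. Qed.

End IntegerPowers.

Lemma gmulfXz (G H : groupType) (f : hom G H) x i :
  f (expgz x i) = expgz (f x) i.
Proof. by case: i => n /=; rewrite ?gmulfXVn ?gmulfXn. Qed.

(** * Mapping out of a presented group *)

Section WordValue.
Variables (X : choiceType) (R : word X -> word X -> Prop).

Definition word_val (G : groupType) (x : X -> G) (w : word X) : G :=
  (\prod_(a <- w) (if a.2 then (x a.1)^-1 else x a.1))%g.

Lemma word_val_cat (G : groupType) (x : X -> G) u v :
  word_val x (u ++ v) = (word_val x u * word_val x v)%g.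
Proof. exact: big_cat. Qed.

Lemma word_val_cons (G : groupType) (x : X -> G) a w :
  word_val x (a :: w) = ((if a.2 then (x a.1)^-1 else x a.1) * word_val x w)%g.
Proof. exact: big_cons. Qed.

Lemma word_val_nil (G : groupType) (x : X -> G) : word_val x [::] = 1%g.
Proof. exact: big_nil. Qed.

Lemma word_val_pow (G : groupType) (x : X -> G) c z :
  word_val x (word_pow c z) = expgz (x c) z.
Proof.
have E (b : bool) n : word_val x (nseq n (c, b)) =
    ((if b then (x c)^-1 else x c) ^+ n)%g.
  by elim: n => [|n IHn]; rewrite ?word_val_nil // word_val_cons IHn expgS.
by case: z => n; rewrite /word_pow E //= expVgn.
Qed.

Lemma word_val_eq (G : groupType) (x : X -> G) u v :
    (forall u v, R u v -> word_val x u = word_val x v) ->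
  word_eq R u v -> word_val x u = word_val x v.
Proof.
move=> xR; elim=> {u v} //.
- by case=> c [] /=; rewrite !word_val_cons word_val_nil /= mulg1 ?mulgV ?mulVg.
- by move=> u u' v v' _ Eu _ Ev; rewrite !word_val_cat Eu Ev.
- by move=> u v w _ -> _.
Qed.

Definition pres_gen (c : X) : presented R := pres_class R [:: (c, false)].

Lemma word_val_gen w : word_val pres_gen w = pres_class R w.
Proof.
elim: w => [|[c b] w IHw]; first exact: word_val_nil.
rewrite word_val_cons IHw -cat1s -pres_mulE; congr (_ * _)%g.
by case: b => //=; rewrite -[LHS]/(pres_inv _) pres_invE.
Qed.

Lemma pres_rel u v : R u v -> word_val pres_gen u = word_val pres_gen v.
Proof. by move=> uv; rewrite !word_val_gen; apply/pres_classP; exact: word_eq_rel. Qed.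

(** Von Dyck's theorem. *)
Lemma pres_lift (G : groupType) (x : X -> G) :
    (forall u v, R u v -> word_val x u = word_val x v) ->
  exists f : hom (presented R) G, forall c, f (pres_gen c) = x c.
Proof.
move=> xR; pose f (g : presented R) := word_val x (pres_word g).
have fE w : f (pres_class R w) = word_val x w.
  exact: word_val_eq xR (pres_classK _ _).
have fM : {morph f : g h / (g * h)%g}.
  by move=> g h; rewrite -[(g * h)%g]/(pres_class _ _) fE word_val_cat.
exists (hom_of fM) => c; rewrite -[LHS]/(f _) fE.
by rewrite word_val_cons word_val_nil mulg1.
Qed.

Lemma pres_ext (G : groupType) (f g : hom (presented R) G) :
  (forall c, f (pres_gen c) = g (pres_gen c)) -> f =1 g.
Proof.
move=> fg p; rewrite -(pres_wordK p) -word_val_gen /word_val !gmulf_prod.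
by apply: eq_bigr => -[c []] _ /=; rewrite ?gmulfV fg.
Qed.

End WordValue.

(** * The factors of the free product *)

Definition Zmod_gen (m : nat) : Zmod m := inZp 1 : 'I_m.-1.+1.

Lemma Zmod_genX (m i : nat) : (Zmod_gen m ^+ i)%g = inZp i :> 'I_m.-1.+1.
Proof.
elim: i => [|i IHi]; first by apply: val_inj; rewrite /= mod0n.
rewrite expgS IHi; apply: val_inj => /=.
by rewrite modnDm.
Qed.

Lemma Zmod_gen_order (m : nat) : (0 < m)%N -> (Zmod_gen m ^+ m = 1)%g.
Proof.
move=> m_gt0; rewrite Zmod_genX; apply: val_inj => /=.
by rewrite prednK // modnn.
Qed.

Lemma Zmod_lift (m : nat) (G : groupType) (x : G) : (0 < m)%N ->
    (x ^+ m = 1)%g ->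
  exists f : hom (Zmod m) G, f (Zmod_gen m) = x.
Proof.
move=> m_gt0 xm; pose f (i : Zmod m) := (x ^+ (i : 'I_m.-1.+1))%g.
have x_mod i : (x ^+ (i %% m) = x ^+ i)%g.
  by rewrite {2}(divn_eq i m) expgnDr mulnC expgnA xm expg1n mul1g.
have fM : {morph f : i j / (i * j)%g}.
  by move=> i j; rewrite /f -expgnDr -[RHS]x_mod -[X in (_ %% X)%N](prednK m_gt0).
exists (hom_of fM); rewrite -[LHS]/(x ^+ (1 %% m.-1.+1))%g.
by rewrite prednK // x_mod expg1.
Qed.

Lemma Zmod_ext (m : nat) (G : groupType) (f g : hom (Zmod m) G) :
  f (Zmod_gen m) = g (Zmod_gen m) -> f =1 g.
Proof.
move=> fg i; have -> : i = (Zmod_gen m ^+ (i : 'I_m.-1.+1))%g.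
  by rewrite Zmod_genX valZpK.
by rewrite !gmulfXn fg.
Qed.

Definition Zgroup_gen : Zgroup := 1 : int.

Lemma Zgroup_genX (i : int) : expgz Zgroup_gen i = i.
Proof.
have E n : (Zgroup_gen ^+ n)%g = n%:Z.
  elim: n => // n IHn; rewrite expgS IHn -[LHS]/((1 : int) + n%:Z); lia.
by case: i => n; rewrite /= E.
Qed.

Lemma Zgroup_lift (G : groupType) (x : G) :
  exists f : hom Zgroup G, f Zgroup_gen = x.
Proof.
have fM : {morph (expgz x : Zgroup -> G) : i j / (i * j)%g} := expgzD x.
by exists (hom_of fM); exact: expgz1.
Qed.

Lemma Zgroup_ext (G : groupType) (f g : hom Zgroup G) :
  f Zgroup_gen = g Zgroup_gen -> f =1 g.
Proof. by move=> fg i; rewrite -(Zgroup_genX i) !gmulfXz fg. Qed.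

Section FreeProduct.
Variables G H : groupType.

Definition fp_inl (x : G) : free_product G H :=
  pres_gen (@free_product_rel G H) (inl x).
Definition fp_inr (x : H) : free_product G H :=
  pres_gen (@free_product_rel G H) (inr x).

Lemma fp_inlM : {morph fp_inl : x y / (x * y)%g}.
Proof.
move=> x y; have := pres_rel (free_product_rel_l H x y).
by rewrite !word_val_cons !word_val_nil /= !mulg1.
Qed.

Lemma fp_inrM : {morph fp_inr : x y / (x * y)%g}.
Proof.
move=> x y; have := pres_rel (free_product_rel_r G x y).
by rewrite !word_val_cons !word_val_nil /= !mulg1.
Qed.

HB.instance Definition _ :=
  isUMagmaMorphism.Build G (free_product G H) fp_inl (morph1 fp_inlM, fp_inlM).
HB.instance Definition _ :=
  isUMagmaMorphism.Build H (free_product G H) fp_inr (morph1 fp_inrM, fp_inrM).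

Lemma fp_lift (K : groupType) (f : hom G K) (g : hom H K) :
  exists h : hom (free_product G H) K,
    h \o fp_inl =1 f /\ h \o fp_inr =1 g.
Proof.
have [|h hE] := @pres_lift _ (@free_product_rel G H) K
    (fun c => match c with inl x => f x | inr y => g y end).
  by move=> _ _ [] x y; rewrite !word_val_cons !word_val_nil /= !mulg1 gmulfM.
by exists h; split=> x; exact: hE.
Qed.

Lemma fp_ext (K : groupType) (f g : hom (free_product G H) K) :
  f \o fp_inl =1 g \o fp_inl -> f \o fp_inr =1 g \o fp_inr -> f =1 g.
Proof. by move=> fgl fgr; apply: pres_ext => -[] x; [exact: fgl | exact: fgr]. Qed.

End FreeProduct.

Arguments fp_inl {G} H x.
Arguments fp_inr G {H} x.

(** * The universal property of the group with relators of length three *)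

Section Universal.
Variable n : nat.

(** Subscripts range over all integers and the family is periodic, so that
    subscripts can be computed with freely. *)
Definition cyc_rel (k l : int) (G : groupType) (x : int -> G) : Prop :=
  (forall i, x (i + n%:Z) = x i) /\
  (forall i, (x i * x (i + k)%R * x (i + l)%R = 1)%g).

(** The pair (G, x) is the group with relators x_i x_(i+k) x_(i+l) and its
    generating family.  Working with this property rather than with a
    presentation lets the generating family be changed while G stays the same. *)
Definition cyc_universal (k l : int) (G : groupType) (x : int -> G) : Prop :=
  [/\ cyc_rel k l x,
      forall (H : groupType) (y : int -> H), cyc_rel k l y ->
        exists f : hom G H, forall i, f (x i) = y i
    & forall (H : groupType) (f g : hom G H),
        (forall i, f (x i) = g (x i)) -> f =1 g].

Lemma cyc_period (G : groupType) (x : int -> G) :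
  (forall i, x (i + n%:Z) = x i) -> forall i j, (i = j %[mod n])%Z -> x i = x j.
Proof.
move=> xn i j /eqP; rewrite eqz_mod_dvd => /dvdzP[q ijq].
have {ijq}->: i = j + q * n by rewrite -ijq; ring.
elim/int_rect: q => [|q IHq|q IHq]; first by rewrite mul0r addr0.
  by rewrite PoszS1 mulrDl mul1r addrA xn.
by rewrite OppzS1 -[LHS]xn -IHq; congr x; ring.
Qed.

Lemma cyc_rel_mod (k k' l l' : int) (G : groupType) (x : int -> G) :
    (k = k' %[mod n])%Z -> (l = l' %[mod n])%Z ->
  cyc_rel k l x -> cyc_rel k' l' x.
Proof.
move=> kk' ll' [xn xkl]; split=> // i; rewrite -[RHS](xkl i).
by congr (_ * _ * _)%g; apply: cyc_period xn _ _ _;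
  rewrite -modzDmr -1?kk' -1?ll' modzDmr.
Qed.

Lemma cyc_universal_mod (k k' l l' : int) (G : groupType) (x : int -> G) :
    (k = k' %[mod n])%Z -> (l = l' %[mod n])%Z ->
  cyc_universal k l x -> cyc_universal k' l' x.
Proof.
move=> kk' ll' [xR x_lift x_ext]; split=> //; first exact: cyc_rel_mod xR.
by move=> H y yR; apply: x_lift; apply: cyc_rel_mod yR.
Qed.

Lemma mulg3_rot (G : groupType) (a b c : G) :
  (a * b * c = 1 -> b * c * a = 1)%g.
Proof. by rewrite -mulgA => /mulg1_eq <-; rewrite mulVg. Qed.

Lemma cyc_rel_rot (k l : int) (G : groupType) (x : int -> G) :
  cyc_rel k l x -> cyc_rel (l - k) (- k) x.
Proof.
case=> xn xkl; split=> // i; have /mulg3_rot := xkl (i - k).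
by rewrite subrK -addrA (addrC _ l).
Qed.

(** Rotating relators: b c a = 1 when a b c = 1.  Three rotations give back
    (k, l), which is how the converse direction is obtained. *)
Lemma cyc_universal_rot (k l : int) (G : groupType) (x : int -> G) :
  cyc_universal k l x -> cyc_universal (l - k) (- k) x.
Proof.
case=> xR x_lift x_ext; split=> //; first exact: cyc_rel_rot.
move=> H y /cyc_rel_rot/cyc_rel_rot yR; apply: x_lift.
by apply: cyc_rel_mod yR; congr (_ %% _)%Z; ring.
Qed.

Lemma cyc_rel_inv (k l : int) (G : groupType) (x : int -> G) :
  cyc_rel k l x -> cyc_rel l k (fun i => (x i)^-1)%g.
Proof.
case=> xn xkl; split=> i; first by rewrite xn.
by rewrite -mulgA -!invgM (mulg3_rot (xkl i)) invg1.
Qed.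

(** The inverse of a relator is the relator of the inverses in reverse order. *)
Lemma cyc_universal_inv (k l : int) (G : groupType) (x : int -> G) :
  cyc_universal k l x -> cyc_universal l k (fun i => (x i)^-1)%g.
Proof.
case=> xR x_lift x_ext; split; first exact: cyc_rel_inv.
  move=> H y /cyc_rel_inv/x_lift[f fx].
  by exists f => i; rewrite gmulfV fx invgK.
by move=> H f g fg; apply: x_ext => i; apply: invg_inj; rewrite -!gmulfV.
Qed.

Lemma cyc_rel_scale (v k l : int) (G : groupType) (x : int -> G) :
  cyc_rel (v * k) (v * l) x -> cyc_rel k l (fun i => x (v * i)).
Proof.
case=> xn xkl; split=> i; last by rewrite !mulrDr.
by apply: cyc_period xn _ _ _; rewrite mulrDr addrC modzMDl.
Qed.

(** Multiplication by the unit u permutes the subscripts modulo n; v is its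
    inverse. *)
Lemma cyc_universal_scale (u v k l : int) (G : groupType) (x : int -> G) :
    (u * v = 1 %[mod n])%Z ->
  cyc_universal k l x -> cyc_universal (u * k) (u * l) (fun i => x (v * i)).
Proof.
move=> uv1; have uvE i : (v * (u * i) = i %[mod n])%Z.
  by rewrite mulrA (mulrC v) -modzMml uv1 modzMml mul1r.
have vuE i : (u * (v * i) = i %[mod n])%Z by rewrite mulrCA uvE.
case=> xR x_lift x_ext; have xn := cyc_period xR.1; split.
- by apply: cyc_rel_scale; apply: cyc_rel_mod xR; rewrite uvE.
- move=> H y yR; have [f fx] := x_lift _ _ (cyc_rel_scale yR).
  by exists f => i; rewrite fx; apply: cyc_period yR.1 _ _ _.
- move=> H f g fg; apply: x_ext => i.
  by rewrite -(xn _ _ (uvE i)).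
Qed.

(** In the target groups the families are given by formulas in (-2)^j, which
    make sense for natural j only; periodicity extends them to all integers. *)
Lemma cyc_rel_nat (k l : nat) (H : groupType) (y : nat -> H) : (0 < n)%N ->
    (forall j, y (j + n)%N = y j) ->
    (forall j, (y j * y (j + k)%N * y (j + l)%N = 1)%g) ->
  exists2 z : int -> H, cyc_rel k l z & forall j : nat, z j = y j.
Proof.
move=> n_gt0 yn ykl; have n_neq0 : n%:Z != 0 by lia.
pose z (i : int) := y `|(i %% n)%Z|%N.
have zE (j : nat) : z j = y j.
  rewrite /z modz_nat absz_nat [in RHS](divn_eq j n).
  by elim: (j %/ n)%N => [|q IHq] //; rewrite mulSn -addnA addnC yn.
have zn (i : int) : z (i + n) = z i by rewrite /z modzDr.
exists z => //; split=> // i.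
have [j ij] : exists j : nat, (i = j %[mod n])%Z.
  exists `|(i %% n)%Z|%N; rewrite gez0_abs ?modz_ge0 //.
  by rewrite modz_mod.
have zD (d : nat) : z (i + d) = y (j + d)%N.
  by rewrite -zE; apply: cyc_period zn _ _ _; rewrite PoszD -modzDml ij modzDml.
by rewrite -{1}(addr0 i) !zD addn0.
Qed.

End Universal.

Lemma cyc_pres_universal (n : nat) (n_gt0 : (0 < n)%N) (k l : int) :
  exists x : int -> cyc_pres (word3 n_gt0 k l), cyc_universal n k l x.
Proof.
have n_neq0 : n%:Z != 0 by lia.
pose s := subscript n_gt0.
have s_val i : (s i : nat)%:Z = (i %% n)%Z by rewrite /= gez0_abs ?modz_ge0.
have s_mod i j : (i = j %[mod n])%Z -> s i = s j.
  by move=> ij; apply: val_inj; rewrite /= ij.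
have s_ord (i : 'I_n) : s i = i.
  by apply: val_inj; rewrite /= modz_nat absz_nat modn_small.
have s_ordS i : ordS (s i) = s (i + 1).
  apply: val_inj; rewrite [LHS]/= -[LHS]absz_nat -modz_nat.
  by rewrite PoszS1 s_val modzDml.
have wE j : iter j (@word_shift n) (word3 n_gt0 k l) =
    [seq (s (j%:Z + i), false) | i <- [:: 0; k; l]].
  elim: j => [|j IHj] /=; first by rewrite !add0r.
  rewrite IHj /= !s_ordS PoszS1.
  by rewrite !(addrAC _ 1).
pose x i := pres_gen (cyc_pres_rel (word3 n_gt0 k l)) (s i).
have x_val (H : groupType) (y : 'I_n -> H) (j : nat) :
    word_val y (iter j (@word_shift n) (word3 n_gt0 k l)) =
    (y (s j%:Z) * y (s (j%:Z + k)) * y (s (j%:Z + l)))%g.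
  by rewrite wE !word_val_cons word_val_nil /= mulg1 mulgA addr0.
exists x; split.
- split=> i; first by congr pres_gen; apply: s_mod; rewrite modzDr.
  have sE d : s (i + d) = s ((s i : nat)%:Z + d).
    by apply: s_mod; rewrite s_val modzDml.
  have := pres_rel (CycPresRel (word3 n_gt0 k l) (ltn_ord (s i))).
  by rewrite x_val word_val_nil s_ord /x !sE.
- move=> H y [yn ykl].
  have yE i : y (s i : nat)%:Z = y i.
    by apply: (cyc_period yn); rewrite s_val modz_mod.
  have [|f fE] := @pres_lift _ (cyc_pres_rel (word3 n_gt0 k l)) H
      (fun i => y (i : nat)%:Z).
    by move=> _ _ [j _]; rewrite x_val !yE ykl word_val_nil.
  by exists f => i; rewrite fE yE.
- move=> H f g fg; apply: pres_ext => i.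
  by have := fg i; rewrite /x s_ord.
Qed.

(** * Consequences of the relators when 3k = 0 modulo n *)

Definition geom (j : nat) : int := \sum_(i < j) (-2) ^+ i.

Lemma geom0 : geom 0 = 0.
Proof. exact: big_ord0. Qed.

Lemma geomS j : geom j.+1 = geom j + (-2) ^+ j.
Proof. exact: big_ord_recr. Qed.

Lemma exprN2 j : (-2) ^+ j = 1 - 3 * geom j.
Proof.
elim: j => [|j IHj]; first by rewrite geom0.
by rewrite geomS exprS IHj; ring.
Qed.

Lemma geomD i j : geom (i + j) = geom i + (-2) ^+ i * geom j.
Proof.
elim: j => [|j IHj]; first by rewrite addn0 geom0 mulr0 addr0.
by rewrite addnS !geomS IHj exprD; ring.
Qed.

(** So the orders occurring in the theorem are, up to sign, 3 g_n, g_n and g_m. *)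
Lemma signed_exp2 j : 2 ^+ j - (-1) ^+ j = - (-1) ^+ j * (3 * geom j) :> int.
Proof.
have -> : 2 ^+ j = (-1) ^+ j * (-2) ^+ j :> int by rewrite -exprMn; congr (_ ^+ _).
by rewrite exprN2; ring.
Qed.

Section Triples.
Variables (n : nat) (k l : int) (G : groupType) (x : int -> G).
Hypotheses (xR : cyc_rel n k l x) (k3 : (3 * k = 0 %[mod n])%Z).

Definition triple (i : int) : G := (x i * x (i + k)%R * x (i + 2 * k)%R)%g.

Lemma cyc_3k i : x (i + 3 * k) = x i.
Proof. by apply: (cyc_period xR.1); rewrite -modzDmr k3 modzDmr addr0. Qed.

Lemma triple_period i : triple (i + n%:Z) = triple i.
Proof. by rewrite /triple !(addrAC _ n%:Z) !xR.1. Qed.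

(** Conjugating by the first factor rotates the product, as x_(i+3k) = x_i. *)
Lemma triple_conj i : triple (i + k) = ((x i)^-1 * triple i * x i)%g.
Proof.
rewrite /triple -!addrA (_ : k + k = 2 * k) 1?(_ : k + 2 * k = 3 * k); try ring.
by rewrite cyc_3k !mulgA mulVg mul1g.
Qed.

(** The relator at i + k says that x_(i+k+l) inverts x_(i+k) x_(i+2k). *)
Lemma cyc_step i : x (i + (k + l)) = ((triple i)^-1 * x i)%g.
Proof.
have := xR.2 (i + k); rewrite -!addrA (_ : k + k = 2 * k); last ring.
by move/mulg1_eq <-; rewrite /triple !invgM -!mulgA mulVg mulg1.
Qed.

(** With a, b, c the three factors, the shifted product is
    (bc)^-1 (ca)^-1 (ab)^-1 = (ab ca bc)^-1 = (abc)^-2. *)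
Lemma triple_step i : triple (i + (k + l)) = expgz (triple i) (-2).
Proof.
rewrite {1}/triple !(addrAC _ (k + l)) !cyc_step triple_conj.
rewrite (_ : i + 2 * k = i + k + k) ?triple_conj; last ring.
rewrite -[-2]/(- (1 + 1)) expgzN expgzD expgz1.
rewrite /triple (_ : i + 2 * k = i + k + k); last ring.
set a := x i; set b := x (i + k); set c := x (i + k + k).
by rewrite !invgM !invgK !mulgA ?(mulgK, mulgVK).
Qed.

Lemma triple_steps i (j : nat) :
  triple (i + j%:Z * (k + l)) = expgz (triple i) ((-2) ^+ j).
Proof.
elim: j => [|j IHj]; first by rewrite mul0r addr0 expgz1.
by rewrite PoszS1 mulrDl mul1r addrA triple_step IHj -expgzM exprSr.
Qed.

Lemma cyc_steps i (j : nat) :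
  x (i + j%:Z * (k + l)) = (expgz (triple i) (- geom j) * x i)%g.
Proof.
elim: j => [|j IHj]; first by rewrite mul0r addr0 geom0 mul1g.
rewrite PoszS1 mulrDl mul1r addrA cyc_step triple_steps IHj -expgzN mulgA -expgzD.
by congr (expgz _ _ * _)%g; rewrite geomS; ring.
Qed.

End Triples.

(** It is enough to compare g \o f with the identity on the generators. *)
Lemma isomorphic_cyc (n : nat) (k l : int) (G H : groupType) (x : int -> G)
    (f : hom G H) (g : hom H G) : (0 < n)%N -> cyc_universal n k l x ->
    (forall j : nat, g (f (x j)) = x j) -> cancel g f ->
  isomorphic G H.
Proof.
move=> n_gt0 [[xn _] _ x_ext] gfx gK.
apply: isomorphic_can gK => u; apply: (x_ext _ (g \o f) idfun) => i /=.
have -> // : x i = x `|(i %% n)%Z|%N.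
by apply: cyc_period xn _ _ _; rewrite gez0_abs ?modz_ge0 ?modz_mod //; lia.
Qed.

(** * The cyclic case: k = 0 and l = 1 *)

Lemma absz_signed_exp2 n : `|(2 ^+ n - (-1) ^+ n : int)|%N = `|(3 * geom n)%R|%N.
Proof. by rewrite signed_exp2 mulNr abszN abszMsign. Qed.

Lemma divz_signed_exp2 n : ((2 ^+ n - (-1) ^+ n) %/ 3)%Z = - (-1) ^+ n * geom n.
Proof. by rewrite signed_exp2 mulrCA mulrC mulzK. Qed.

Lemma expgz_absz (G : groupType) (x : G) i :
  expgz x i = 1%g <-> (x ^+ `|i| = 1)%g.
Proof.
case: i => n //=; split=> [/eqP|->]; last exact: invg1.
by rewrite invg_eq1 => /eqP.
Qed.

Lemma geom_neq0 j : (0 < j)%N -> geom j != 0.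
Proof.
move=> j_gt0; apply/eqP => g0; have := exprN2 j; rewrite g0 mulr0 subr0.
by move/(congr1 absz); rewrite abszX -[RHS](exp1n j); case: j j_gt0 {g0} => // j _ /eqP; rewrite eqn_exp2r.
Qed.

Lemma cyc_universal_01_iso (n : nat) (G : groupType) (x : int -> G) :
    (0 < n)%N -> cyc_universal n 0 1 x ->
  isomorphic G (Zmod `|(2 ^+ n - (-1) ^+ n : int)|%N).
Proof.
move=> n_gt0 xU; rewrite absz_signed_exp2; set N := `|_|%N.
have N_gt0 : (0 < N)%N by rewrite absz_gt0 mulf_neq0 ?geom_neq0.
have [[xn xkl] x_lift _] := xU.
have xS i : x (i + 1) = expgz (x i) (-2).
  have := xkl i; rewrite addr0 => /mulg1_eq <-.
  by rewrite -[-2]/(- (1 + 1)) expgzN expgzD expgz1.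
have xE (j : nat) : x j = expgz (x 0) ((-2) ^+ j).
  elim: j => [|j IHj]; first by rewrite expgz1.
  by rewrite PoszS1 xS IHj -expgzM exprSr.
pose a := Zmod_gen N; have aN : expgz a (3 * geom n) = 1%g.
  exact/expgz_absz/Zmod_gen_order.
pose y (j : nat) := expgz a ((-2) ^+ j).
have [j|j|z zR zE] := @cyc_rel_nat n 0 1 _ y n_gt0.
- apply: (expgz_mod aN); apply/dvdzP; exists (- (-2) ^+ j).
  by rewrite exprD (exprN2 n); ring.
- rewrite addn0 addn1 /y -!expgzD exprS.
  by rewrite [X in expgz _ X](_ : _ = 0) //; ring.
have [f fx] := x_lift _ _ zR.
have [g ga] : exists g : hom (Zmod N) G, g a = x 0.
  apply: Zmod_lift => //; apply/expgz_absz.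
  rewrite (_ : 3 * _ = 1 - (-2) ^+ n); last by rewrite exprN2; ring.
  by rewrite expgzD expgzN -(xE n) -[n%:Z]add0r xn expgz1 mulgV.
apply: (isomorphic_cyc (f := f) (g := g) n_gt0 xU).
  by move=> j; rewrite fx zE gmulfXz ga xE.
by apply: (@Zmod_ext _ _ (f \o g) idfun); rewrite /= ga fx (zE 0) /y expgz1.
Qed.

(** * The metacyclic case: k = m, l = 1 - m and n = 3m *)

Section Metacyclic.
Variables M N R lambda : int.
Let q := ((lambda * M) %/ gcdz M (R - 1))%Z.

Definition metacyclic_gen (c : bool) : Bgroup M N R lambda :=
  pres_gen (metacyclic_rel M N R lambda) c.

Definition metacyclic_pair (G : groupType) (a b : G) : Prop :=
  [/\ expgz a M = 1%g, (b * a * b^-1)%g = expgz a R & expgz b N = expgz a q].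

Lemma metacyclic_gen_pair :
  metacyclic_pair (metacyclic_gen false) (metacyclic_gen true).
Proof.
split; rewrite -!(word_val_pow metacyclic_gen) -1?(word_val_nil metacyclic_gen).
- exact: pres_rel (metacyclic_rel_a _ _ _ _).
- have := pres_rel (metacyclic_rel_conj M N R lambda).
  by rewrite !word_val_cons word_val_nil /= mulg1 mulgA.
- exact: pres_rel (metacyclic_rel_b _ _ _ _).
Qed.

Lemma metacyclic_lift (G : groupType) (a b : G) : metacyclic_pair a b ->
  exists f : hom (Bgroup M N R lambda) G,
    f (metacyclic_gen false) = a /\ f (metacyclic_gen true) = b.
Proof.
case=> aM ba bN.
have [|f fE] := @pres_lift _ (metacyclic_rel M N R lambda) G
    (fun c => if c then b else a).
  move=> _ _ []; rewrite ?word_val_pow ?word_val_nil //.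
  by rewrite !word_val_cons word_val_nil /= mulg1 mulgA.
by exists f; split; exact: fE.
Qed.

Lemma metacyclic_ext (G : groupType) (f g : hom (Bgroup M N R lambda) G) :
    f (metacyclic_gen false) = g (metacyclic_gen false) ->
    f (metacyclic_gen true) = g (metacyclic_gen true) ->
  f =1 g.
Proof. by move=> fga fgb; apply: pres_ext => -[]. Qed.

End Metacyclic.

Lemma conj_expgz (G : groupType) (a b : G) R i :
  (b * a * b^-1)%g = expgz a R -> (b * expgz a i)%g = (expgz a (R * i) * b)%g.
Proof. by move=> bab; rewrite expgzM -bab -expgzJ mulgVK. Qed.

Lemma geom3n m : geom (3 * m) = 3 * geom m * (1 - 3 * geom m + 3 * geom m ^+ 2).
Proof. by rewrite !mulSn mul0n addn0 !geomD !exprN2; ring. Qed.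

(** With g = g_m and z = 1 - 3g one has M = |3g| T and
    R - 1 = z^2 - 1 = 3g (3g - 2), where T is prime to 3g - 2; so the exponent of
    a in the relation for b^3 is T. *)
Lemma metacyclic_exponents m (n := (3 * m)%N) (z : int := (-2) ^+ m) 
    (M : int := ((2 ^+ n - (-1) ^+ n) %/ 3)%Z) : (0 < m)%N ->
  [/\ (2 ^+ ((2 * n) %/ 3)%N = z ^+ 2 :> int), M = - (-1) ^+ n * geom n
    & (1 * M %/ gcdz M (z ^+ 2 - 1))%Z = 1 - 3 * geom m + 3 * geom m ^+ 2].
Proof.
move=> m_gt0; have ME : M = - (-1) ^+ n * geom n by exact: divz_signed_exp2.
have M_ge0 : 0 <= M.
  have : 0 <= 3 * M.
    rewrite ME (_ : 3 * _ = 2 ^+ n - (-1) ^+ n); last by rewrite signed_exp2; ring.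
    rewrite subr_ge0 (@le_trans _ _ 1) ?exprn_ege1 //.
    by rewrite -signr_odd; case: odd.
  by lia.
split=> //.
  rewrite /n mulnCA mulKn // mulnC exprM /z (_ : 2 ^+ m = (-1) ^+ m * (-2) ^+ m :> int).
    by rewrite exprMn sqrr_sign mul1r.
  by rewrite -exprMn.
set g := geom m; set T := 1 - 3 * g + 3 * g ^+ 2.
have nE : geom n = (3 * g) * T by exact: geom3n.
have zE : z = 1 - 3 * g by exact: exprN2.
have g_neq0 : g != 0 by exact: geom_neq0.
have T_gt0 : 0 < T by rewrite /T; nia.
have M_abs : M = `|3 * g| * T.
  rewrite -(gtr0_norm T_gt0) -normrM -nE -[LHS]ger0_norm //.
  by rewrite ME mulNr normrN normrMsign.
(* T = (3g - 2) g + (1 - g) and 3 (1 - g) = 1 - (3g - 2). *)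
have T_coprime : coprimez T (3 * g - 2).
  by apply/coprimezP; exists (3, 1 - 3 * g); rewrite /= /T; ring.
have -> : gcdz M (z ^+ 2 - 1) = `|3 * g|.
  rewrite (_ : gcdz M _ = gcdz (3 * g * T) (3 * g * (3 * g - 2))).
    by rewrite -mulz_gcdr (eqP T_coprime) mulr1.
  rewrite -nE zE ME mulNr gcdNz; congr (_%:Z); congr gcdn.
    by rewrite abszMsign.
  by congr absz; ring.
by rewrite mul1r M_abs mulKz // normr_eq0 mulf_neq0.
Qed.

(** Here a and b stand both for the generators of B and for the elements p_0 and
    x_0 of G, so the same computation serves the two directions. *)
Section MetacyclicFamily.
Variables (m : nat) (K : groupType) (a b : K).
Let g := geom m.
Let z : int := (-2) ^+ m.
Let T : int := 1 - 3 * g + 3 * g ^+ 2.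

Definition metacyclic_family (j : nat) : K := (expgz a (- geom j) * b)%g.

Lemma metacyclic_family_prod i j l :
    (b * a * b^-1)%g = expgz a (z ^+ 2) ->
  (metacyclic_family i * metacyclic_family j * metacyclic_family l)%g =
  (expgz a (- (geom i + z ^+ 2 * geom j + z ^+ 4 * geom l)) * expgz b 3)%g.
Proof.
move=> ba; have -> : expgz b 3 = (b * b * b)%g by rewrite /= !expgS expg0 mulg1 mulgA.
have bE e u : (b * (expgz a e * u) = expgz a (z ^+ 2 * e) * (b * u))%g.
  by rewrite mulgA (conj_expgz _ ba) mulgA.
rewrite /metacyclic_family -!mulgA !bE !mulgA -!expgzD.
by congr (expgz _ _ * _ * _ * _)%g; ring.
Qed.

Hypotheses (aM : expgz a (geom (3 * m)) = 1%g)
  (ba : (b * a * b^-1)%g = expgz a (z ^+ 2)).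

Lemma metacyclic_family_period j :
  metacyclic_family (j + 3 * m) = metacyclic_family j.
Proof.
congr (_ * _)%g; apply: (expgz_mod aM); apply/dvdzP; exists (- (-2) ^+ j).
by rewrite geomD; ring.
Qed.

(** The relation b^3 = a^T says exactly that a is the product p_0 formed from
    the family. *)
Lemma metacyclic_family_triple :
  (metacyclic_family 0 * metacyclic_family m * metacyclic_family (2 * m))%g = a
    <-> expgz b 3 = expgz a T.
Proof.
rewrite metacyclic_family_prod // geom0 add0r expgzN.
set e := z ^+ 2 * _ + _; have eT : expgz a (e + 1) = expgz a T.
  (* Substituting g = (1 - z) / 3, the difference of the exponents is
     (1 - z^3) / 3 times z^3 - z + 2, and (1 - z^3) / 3 = geom (3 * m). *)
  apply: (expgz_mod aM); apply/dvdzP; exists (z ^+ 3 - z + 2).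
  rewrite (_ : 3 * m = m + (m + m))%N /e; last by lia.
  rewrite (_ : 2 * m = m + m)%N; last by lia.
  by rewrite !geomD /T /z !exprN2 -/g; ring.
rewrite -eT expgzS; split=> [h|->]; last by rewrite mulKg.
by rewrite -{2}h mulVKg.
Qed.

Lemma metacyclic_family_rel j : expgz b 3 = expgz a T ->
  (metacyclic_family j * metacyclic_family (j + m) *
   metacyclic_family (j + (2 * m).+1) = 1)%g.
Proof.
move=> b3; rewrite metacyclic_family_prod // b3 -expgzD.
apply: (expgz_dvd aM); apply/dvdzP.
(* With y = (-2)^j and g_j = (1 - y) / 3, three times the exponent is
   (1 - z^3) (z + y (2 z^3 + 1)). *)
exists (z + (-2) ^+ j * (2 * z ^+ 3 + 1)).
rewrite (_ : j + (2 * m).+1 = (j + (m + m)).+1)%N; last by lia.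
rewrite (_ : 3 * m = m + (m + m))%N; last by lia.
by rewrite geomS !geomD !exprD /T /z !exprN2 -/g; ring.
Qed.

End MetacyclicFamily.

(** The subscript 1 - m is written 2m + 1, to have a natural number. *)
Lemma cyc_universal_metacyclic_iso (m : nat) (G : groupType) (x : int -> G)
    (n : nat := (3 * m)%N) :
    (0 < m)%N -> cyc_universal n m (2 * m).+1 x ->
  isomorphic G
    (Bgroup ((2 ^+ n - (-1) ^+ n) %/ 3)%Z 3 (2 ^+ ((2 * n) %/ 3)%N) 1).
Proof.
move=> m_gt0 xU; have n_gt0 : (0 < n)%N by rewrite muln_gt0.
have [RE ME qE] := metacyclic_exponents m_gt0.
rewrite -/n in RE ME qE; rewrite {}RE.
move: ((2 ^+ n - (-1) ^+ n) %/ 3)%Z ME qE => M ME qE; set R := (_ ^+ 2 : int).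
have [[xn _] x_lift _] := xU; have xR : cyc_rel n m (2 * m).+1 x by case: xU.
have k3 : (3 * m%:Z = 0 %[mod n])%Z by rewrite -PoszM modzz mod0z.
have M_geom (K : groupType) (a : K) : expgz a M = 1%g <-> expgz a (geom n) = 1%g.
  by rewrite !expgz_absz ME mulNr abszN abszMsign.
pose a := metacyclic_gen M 3 R 1 false; pose b := metacyclic_gen M 3 R 1 true.
have [/M_geom aM ba b3] := metacyclic_gen_pair M 3 R 1.
rewrite qE in b3.
have [j|j|y yR yE] := @cyc_rel_nat n m (2 * m).+1 _ (metacyclic_family a b) n_gt0.
- exact: (metacyclic_family_period _ aM).
- exact: metacyclic_family_rel aM ba j b3.
have [f fx] := x_lift _ _ yR.
pose p := triple m x 0.
have xE (j : nat) : x j = metacyclic_family p (x 0) j.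
  have := cyc_steps xR k3 0 j; rewrite add0r /metacyclic_family => <-.
  apply: (cyc_period xn); apply/eqP; rewrite eqz_mod_dvd; apply/dvdzP.
  by exists (- j%:Z); rewrite /n PoszM PoszS1; ring.
have pM : expgz p (geom n) = 1%g.
  have := xE n; rewrite -[n%:Z]add0r xn => /(congr1 (fun u => u * (x 0)^-1))%g.
  by rewrite mulgV mulgK expgzN => /eqP; rewrite eq_sym invg_eq1 => /eqP.
(* The subscript m is both 0 + k and, modulo n, m (k + l); so p_m is
   x_0^-1 p x_0 and also p^z.  Raising to the power z^2 inverts the latter. *)
have pJ : (x 0 * p * (x 0)^-1)%g = expgz p (((-2) ^+ m) ^+ 2).
  have pmE : triple m x m = expgz p ((-2) ^+ m).
    rewrite -(triple_steps xR k3 0 m) add0r; apply: (cyc_period (triple_period xR)).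
    apply/eqP; rewrite eqz_mod_dvd; apply/dvdzP; exists (- m%:Z).
    by rewrite /n PoszM !PoszS1 PoszM; ring.
  have := triple_conj xR k3 0; rewrite add0r pmE -/p => pz.
  have {1}-> : p = expgz p ((-2) ^+ m * ((-2) ^+ m) ^+ 2).
    rewrite -[LHS]expgz1; apply: (expgz_mod pM); apply/dvdzP; exists 3.
    by rewrite -exprS -exprM mulnC exprN2 -/n; ring.
  by rewrite expgzM expgzJ pz !mulgA mulgV mul1g mulgK.
have p3 : expgz (x 0) 3 = expgz p (1 - 3 * geom m + 3 * geom m ^+ 2).
  by apply/(metacyclic_family_triple pM pJ); rewrite -!xE /p /triple !add0r PoszM.
have [g [ga gb]] : exists g : hom (Bgroup M 3 R 1) G, g a = p /\ g b = x 0.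
  by apply: metacyclic_lift; split; [exact/M_geom | | rewrite qE].
apply: (isomorphic_cyc (f := f) (g := g) n_gt0 xU).
  by move=> j; rewrite fx yE gmulfM gmulfXz ga gb xE.
have fb : f (x 0) = b by rewrite fx (yE 0) /metacyclic_family geom0 mul1g.
have fa : f p = a.
  have := (metacyclic_family_triple aM ba).2 b3 => aE.
  rewrite -[RHS]aE !gmulfM fx (yE 0).
  by congr (_ * _ * _)%g; rewrite fx !add0r yE.
by apply: (@metacyclic_ext _ _ _ _ _ (f \o g) idfun); rewrite /= ?ga ?gb.
Qed.

(** * The free product case: l = 1, k = 0 modulo m and k = 2 modulo 3 *)

Section CyclicFreeZ2.
Variable N : nat.
Hypothesis N_gt0 : (0 < N)%N.

Local Notation P := (free_product (free_product (Zmod N) Zgroup) Zgroup).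

Definition fp3_gen0 : P := fp_inl Zgroup (fp_inl Zgroup (Zmod_gen N)).
Definition fp3_gen1 : P := fp_inl Zgroup (fp_inr (Zmod N) Zgroup_gen).
Definition fp3_gen2 : P := fp_inr (free_product (Zmod N) Zgroup) Zgroup_gen.

Lemma fp3_gen0_order : (fp3_gen0 ^+ N)%g = 1%g.
Proof. by rewrite /fp3_gen0 -!gmulfXn Zmod_gen_order // !gmulf1. Qed.

Lemma fp3_lift (G : groupType) (a c d : G) : (a ^+ N = 1)%g ->
  exists f : hom P G, [/\ f fp3_gen0 = a, f fp3_gen1 = c & f fp3_gen2 = d].
Proof.
move=> aN; have [fa faE] := Zmod_lift N_gt0 aN.
have [fc fcE] := Zgroup_lift c; have [fd fdE] := Zgroup_lift d.
have [f [fl fr]] := fp_lift fa fc; have [h [hl hr]] := fp_lift f fd.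
exists h; split; rewrite -1?faE -1?fcE -1?fdE.
- by rewrite -[RHS]fl -[RHS]hl.
- by rewrite -[RHS]fr -[RHS]hl.
- by rewrite -[RHS]hr.
Qed.

Lemma fp3_ext (G : groupType) (f g : hom P G) :
    f fp3_gen0 = g fp3_gen0 -> f fp3_gen1 = g fp3_gen1 ->
    f fp3_gen2 = g fp3_gen2 ->
  f =1 g.
Proof.
move=> fg0 fg1 fg2; apply: fp_ext; last first.
  exact: (@Zgroup_ext _ (f \o fp_inr _) (g \o fp_inr _) fg2).
apply: (@fp_ext _ _ _ (f \o fp_inl _) (g \o fp_inl _)).
  exact: (@Zmod_ext _ _ (f \o fp_inl _ \o fp_inl _) (g \o fp_inl _ \o fp_inl _) fg0).
exact: (@Zgroup_ext _ (f \o fp_inl _ \o fp_inr _) (g \o fp_inl _ \o fp_inr _) fg1).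
Qed.

End CyclicFreeZ2.

Section FreeFamily.
Variables (m k : nat) (K : groupType) (a c d : K).
Hypotheses (aM : expgz a (geom m) = 1%g) (mk : (m %| k)%N) (k3 : (k %% 3 = 2)%N).

(** The third line is what the relator at j + 2k imposes: the inverse of the
    product of the second line at j + 2k + 1 and the first at j + 2k. *)
Definition free_family (j : nat) : K :=
  match (j %% 3)%N with
  | 0 => (expgz a (- geom j) * c)%g
  | 1 => (d * expgz a (- geom j))%g
  | _ => (c^-1 * expgz a (1 - geom j) * d^-1)%g
  end.

Lemma expgz_geomD (e : int) i j :
  (m %| j)%N -> expgz a (e - geom (i + j)) = expgz a (e - geom i).
Proof.
case/dvdnP=> q ->; elim: q => [|q IHq]; first by rewrite addn0.
rewrite -IHq mulSn addnCA addnC; apply: (expgz_mod aM); apply/dvdzP.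
by exists (- (-2) ^+ (i + q * m)); rewrite geomD; ring.
Qed.

Lemma free_family_period i j :
  (m %| j)%N -> (j %% 3 = 0)%N -> free_family (i + j) = free_family i.
Proof.
move=> mj j3; rewrite /free_family expgz_geomD // -modnDmr j3 addn0.
by rewrite -[- geom (i + j)]add0r expgz_geomD // add0r.
Qed.

(** The three factors have residues r, r + 2 and r + 1 modulo 3, so each line
    of the definition occurs once; the powers of a cancel since
    g_(j+k) = g_j modulo g_m and g_(j+1) = 1 - 2 g_j. *)
Lemma free_family_rel j :
  (free_family j * free_family (j + k) * free_family (j + 1) = 1)%g.
Proof.
rewrite /free_family expgz_geomD // -[- geom (j + k)]add0r expgz_geomD // add0r.
rewrite [in geom (j + 1)]addn1 geomS exprN2; set h := geom j.
have -> : ((j + k) %% 3 = (j %% 3 + 2) %% 3)%N by lia.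
have -> : ((j + 1) %% 3 = (j %% 3 + 1) %% 3)%N by lia.
have [->|->|->] /= : [\/ j %% 3 = 0, j %% 3 = 1 | j %% 3 = 2]%N.
- have : (j %% 3 < 3)%N by rewrite ltn_mod.
  by case: (j %% 3)%N => [|[|[|]]] // _; constructor.
- rewrite !mulgA mulgK mulgVK -!expgzD.
  by rewrite [X in expgz _ X](_ : _ = 0) //; ring.
- rewrite !mulgA mulgK; do 2!rewrite -(mulgA d) -expgzD.
  by rewrite [X in expgz _ X](_ : _ = 0) ?expgz0 ?mulg1 ?mulgV //; ring.
- rewrite !mulgA mulgVK; do 2!rewrite -(mulgA c^-1)%g -expgzD.
  by rewrite [X in expgz _ X](_ : _ = 0) ?expgz0 ?mulg1 ?mulVg //; ring.
Qed.

End FreeFamily.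

Lemma cyc_universal_free_iso (m k : nat) (G : groupType) (x : int -> G)
    (n : nat := (3 * m)%N) :
    (0 < m)%N -> (m %| k)%N -> (k %% 3 = 2)%N -> cyc_universal n k 1 x ->
  isomorphic G
    (free_product (free_product
      (Zmod `|((2 ^+ m - (-1) ^+ m) %/ 3)%Z|%N) Zgroup) Zgroup).
Proof.
move=> m_gt0 mk k_mod3 xU; have n_gt0 : (0 < n)%N by rewrite muln_gt0.
rewrite divz_signed_exp2 mulNr abszN abszMsign; set N := `|geom m|%N.
have N_gt0 : (0 < N)%N by rewrite absz_gt0 geom_neq0.
have [[xn xk1] x_lift _] := xU; have xR : cyc_rel n k 1 x by case: xU.
have [q kE] : exists q, k = (q * m)%N by apply/dvdnP.
have xn_dvd (i j : int) : (n %| i - j)%Z -> x i = x j.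
  by move=> nij; apply: (cyc_period xn); apply/eqP; rewrite eqz_mod_dvd.
have k3 : (3 * k%:Z = 0 %[mod n])%Z.
  by apply/eqP; rewrite eqz_mod_dvd; apply/dvdzP; exists q%:Z; rewrite kE /n !PoszM; ring.
pose a := fp3_gen0 N; pose c := fp3_gen1 N; pose d := fp3_gen2 N.
have aM : expgz a (geom m) = 1%g by apply/expgz_absz/fp3_gen0_order.
have [j|j|y yR yE] := @cyc_rel_nat n k 1 _ (free_family a c d) n_gt0.
- by apply: (free_family_period _ _ aM); rewrite ?dvdn_mull ?modnMr.
- exact: (free_family_rel _ _ aM mk k_mod3 j).
have [f fx] := x_lift _ _ yR.
pose p := triple k x 0.
have pM : expgz p (geom m) = 1%g.
  have := cyc_steps xR k3 0 m; rewrite (xn_dvd _ 0).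
    move/(congr1 (fun u => u * (x 0)^-1))%g; rewrite mulgV mulgK expgzN.
    by move/eqP; rewrite eq_sym invg_eq1 => /eqP.
  apply/dvdzP; exists (k %/ 3).+1%:Z.
  by rewrite {1}(divn_eq k 3) k_mod3 /n PoszS1 PoszD !PoszM; ring.
have x0 (j : nat) : (j %% 3 = 0)%N -> x j = (expgz p (- geom j) * x 0)%g.
  move=> j3; rewrite -(cyc_steps xR k3 0 j); apply: xn_dvd.
  apply/dvdzP; exists (- ((j %/ 3) * q)%N%:Z).
  by rewrite {1 2}(divn_eq j 3) j3 /n kE addn0 !PoszM; ring.
have x1 (j : nat) : (j %% 3 = 1)%N -> x j = (x (2 * k)%N * expgz p (- geom j))%g.
  move=> j3; have := cyc_steps xR k3 (2 * k)%N j.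
  have -> : triple k x (2 * k)%N = (x (2 * k)%N * p * (x (2 * k)%N)^-1)%g.
    have -> : p = triple k x ((2 * k)%N%:Z + k%:Z).
      apply: (cyc_period (triple_period xR)); rewrite -k3; congr (_ %% _)%Z.
      by rewrite PoszM; ring.
    by rewrite (triple_conj xR k3) !mulgA mulgV mul1g mulgK.
  rewrite -expgzJ mulgVK => <-; apply: xn_dvd; apply/dvdzP.
  exists (- ((j %/ 3).+1 * q)%N%:Z).
  by rewrite {1 2}(divn_eq j 3) j3 /n kE PoszD !PoszM PoszS1; ring.
have xE (j : nat) : x j = free_family p (x 0) (x (2 * k)%N) j.
  have [j3|[j3|j3]] : (j %% 3 = 0 \/ j %% 3 = 1 \/ j %% 3 = 2)%N by lia.
  (* For the residues 0 and 1 this is x0 and x1; for 2, both sides are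
     determined by the relator at j + 2k. *)
  - by rewrite (x0 j) // /free_family j3.
  - by rewrite (x1 j) // /free_family j3.
  have mid (u v w : G) : (u * v * w = 1 -> v = u^-1 * w^-1)%g.
    by move=> uvw; rewrite -[LHS](mulKg u) -[(u * v)%g](mulgK w) uvw mul1g.
  pose i := (j + 2 * k)%N.
  have := mid _ _ _ (free_family_rel (x 0) (x (2 * k)%N) pM mk k_mod3 i).
  have -> : free_family p (x 0) (x (2 * k)%N) i = x i.
    by rewrite (x0 i) /free_family (_ : i %% 3 = 0)%N //; lia.
  have -> : free_family p (x 0) (x (2 * k)%N) (i + 1)%N = x (i + 1)%N.
    by rewrite (x1 (i + 1)%N) /free_family (_ : (i + 1) %% 3 = 1)%N //; lia.
  have -> : (i + k = j + 3 * k)%N by rewrite /i; lia.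
  rewrite (free_family_period _ _ pM) ?modnMr ?dvdn_mull // => ->.
  rewrite -(mid _ _ _ (xk1 i)); apply: xn_dvd; apply/dvdzP; exists (- q%:Z).
  by rewrite /i kE /n PoszD !PoszM; ring.
have [g [ga gc gd]] := fp3_lift N_gt0 (x 0) (x (2 * k)%N) ((expgz_absz _ _).1 pM).
apply: (isomorphic_cyc (f := f) (g := g) n_gt0 xU).
  move=> j; rewrite fx yE xE /free_family.
  by case: (j %% 3)%N => [|[|_]]; rewrite !gmulfM ?gmulfV gmulfXz ?ga ?gc ?gd.
have k2 : (2 * k %% 3 = 1)%N by lia.
have yk i (e : int) : (m %| i)%N -> expgz a (e - geom i) = expgz a e.
  by move=> mi; rewrite -[i]add0n (expgz_geomD aM) // geom0 subr0.
have f0 : f (x 0) = c by rewrite fx (yE 0) /free_family geom0 mul1g.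
have fk : f (x k) = (c^-1 * a * d^-1)%g.
  by rewrite fx yE /free_family k_mod3 yk // expgz1.
have f2k : f (x (2 * k)%N) = d.
  by rewrite fx yE /free_family k2 -sub0r yk ?dvdn_mull // mulg1.
have fp : f p = a.
  by rewrite /p /triple !add0r !gmulfM f0 fk -PoszM f2k !mulgA mulgV mul1g mulgVK.
by apply: (@fp3_ext _ _ (f \o g) idfun); rewrite /= ?ga ?gc ?gd.
Qed.

(** * Reduction to the normal forms *)

Definition setwise_coprime (a b c : int) : Prop :=
  forall d : int, (d %| a)%Z -> (d %| b)%Z -> (d %| c)%Z -> (d %| 1)%Z.

Lemma coprimez_common_dvd (a b : int) :
  (forall d : int, (d %| a)%Z -> (d %| b)%Z -> (d %| 1)%Z) -> coprimez a b.
Proof. by move=> /(_ _ (dvdz_gcdl a b) (dvdz_gcdr a b)); rewrite dvdz1. Qed.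

Lemma eqz_modP (n a b : int) : (a = b %[mod n])%Z <-> exists q, a = b + q * n.
Proof.
split=> [/eqP|[q ->]]; last by rewrite addrC modzMDl.
by rewrite eqz_mod_dvd => /dvdzP[q qE]; exists q; rewrite -qE; ring.
Qed.

Section ScalingToNormalForm.
Variables (n : nat) (k l : int) (G : groupType) (x : int -> G).
Hypotheses (n_gt0 : (0 < n)%N) (xU : cyc_universal n k l x)
  (nkl : setwise_coprime n k l).

Lemma cyc_iso_Zmod : (k = 0 %[mod n])%Z ->
  isomorphic G (Zmod `|(2 ^+ n - (-1) ^+ n : int)|%N).
Proof.
move=> k0; have nk : (n %| k)%Z by apply/dvdz_mod0P; rewrite k0 mod0z.
have /coprimezP[[v u] /= uvE] : coprimez n l.
  by apply: coprimez_common_dvd => d dn; apply: nkl => //; apply: dvdz_trans nk.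
have ul : (u * l = 1 %[mod n])%Z by apply/eqz_modP; exists (- v); rewrite -uvE; ring.
apply: cyc_universal_01_iso (cyc_universal_mod _ ul (cyc_universal_scale ul xU)) => //.
by rewrite -modzMmr k0 modzMmr mulr0.
Qed.

Hypothesis k3 : (3 * k = 0 %[mod n])%Z.

Lemma dvdz_third m : n = (3 * m)%N -> (m %| k)%Z.
Proof.
move=> nE; have /eqz_modP[q] := k3; rewrite add0r nE PoszM => kE.
by apply/dvdzP; exists q; lia.
Qed.

(** Modulo m the subscript k vanishes and modulo 3 it is -l; hence a common
    divisor of l and m, or of l and 3, divides k.  So l is a unit modulo n. *)
Lemma cyc_iso_free : (3 %| n)%N -> (3 %| k + l)%Z ->
  isomorphic G
    (free_product (free_product
      (Zmod `|((2 ^+ (n %/ 3)%N - (-1) ^+ (n %/ 3)%N) %/ 3)%Z|%N) Zgroup) Zgroup).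
Proof.
case/dvdnP=> m; rewrite mulnC => nE /dvdzP[t klE]; have mk := dvdz_third nE.
rewrite nE mulKn //.
have /coprimezP[[v u] /= uvE] : coprimez n l.
  rewrite nE PoszM coprimezMl; apply/andP; split; apply: coprimez_common_dvd => d d1 dl.
    apply: nkl => //; first by rewrite nE PoszM dvdz_mulr.
    by rewrite -[k](addrK l) klE rpredB // dvdz_mull.
  by apply: nkl => //; [rewrite nE PoszM dvdz_mull | apply: dvdz_trans mk].
have ul : (u * l = 1 %[mod n])%Z by apply/eqz_modP; exists (- v); rewrite -uvE; ring.
pose k1 := `|((u * k) %% n)%Z|%N; have n_neq0 : n%:Z != 0 by lia.
have k1E : (u * k = k1 %[mod n])%Z by rewrite /k1 gez0_abs ?modz_ge0 ?modz_mod.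
have /eqz_modP[q qE] := k1E; rewrite nE PoszM in qE uvE.
have m_gt0 : (0 < m)%N by move: n_gt0; rewrite nE muln_gt0.
have mk1 : (m %| k1)%N.
  rewrite -[(m %| k1)%N]/(m%:Z %| k1%:Z)%Z (_ : k1%:Z = u * k - q * 3 * m).
    by rewrite rpredB // dvdz_mull.
  by rewrite qE; ring.
have k1_mod3 : (k1 %% 3 = 2)%N.
  have : k1%:Z + 1 = 3 * (u * t - q * m + v * m).
    have -> : k1%:Z = u * k - q * (3 * m) by rewrite qE; ring.
    by rewrite -[X in _ + X = _]uvE (_ : k = t * 3 - l); [ring | rewrite -klE; ring].
  by move=> k1E3; clear -k1E3; lia.
have yU := cyc_universal_mod k1E ul (cyc_universal_scale ul xU).
by rewrite nE in yU; exact: cyc_universal_free_iso yU.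
Qed.

(** As 3k = 0 while k is nonzero, 3 divides n.  Modulo m, k + l is l, and modulo
    3 it is nonzero since (A) fails; hence it is a unit, which is scaled to 1.
    Then k is m or 2m modulo n; a rotation followed by an inversion exchanges
    (k, 1 - k) and (-k, 1 + k), which reduces the second possibility to the
    first. *)
Lemma cyc_iso_metacyclic :
    ~ ((3 %| n)%N /\ (3 %| k + l)%Z) -> (k <> 0 %[mod n])%Z ->
  isomorphic G
    (Bgroup ((2 ^+ n - (-1) ^+ n) %/ 3)%Z 3 (2 ^+ ((2 * n) %/ 3)%N) 1).
Proof.
move=> notA k_neq0; have nk : ~~ (n %| k)%Z.
  by apply/negP => /dvdz_mod0P nk; apply: k_neq0; rewrite nk mod0z.
have n3k : (n %| 3 * k)%Z by apply/dvdz_mod0P; rewrite k3 mod0z.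
have n3 : (3 %| n)%N.
  apply: contraNT nk => n3; rewrite -(Gauss_dvdzr (n := 3)) //.
  by rewrite coprimez_sym coprimezE /= prime_coprime.
have kl3 : ~~ (3 %| k + l)%Z by apply/negP => kl3; apply: notA.
have {n3} [m nE] : exists m, n = (3 * m)%N.
  by case/dvdnP: n3 => m ->; exists m; rewrite mulnC.
have mk := dvdz_third nE.
have /coprimezP[[v u] /= uvE] : coprimez n (k + l).
  rewrite nE PoszM coprimezMl; apply/andP; split.
    by rewrite coprimezE prime_coprime.
  apply: coprimez_common_dvd => d dm dkl; have dk := dvdz_trans dm mk.
  apply: nkl => //; first by rewrite nE PoszM dvdz_mull.
  by rewrite -[l](addKr k) addrC rpredB.
have us : (u * (k + l) = 1 %[mod n])%Z.
  by apply/eqz_modP; exists (- v); rewrite -uvE; ring.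
have m_gt0 : (0 < m)%N by move: n_gt0; rewrite nE muln_gt0.
have yU := cyc_universal_scale us xU.
have /dvdzP[c cE] := mk.
have ucE : u * k = u * c * m by rewrite cE mulrA.
have uc3 : ~~ (3 %| u * c)%Z.
  apply: contra nk => /dvdzP[w wE].
  have nuk : (n %| u * k)%Z by apply/dvdzP; exists w; rewrite ucE wE nE PoszM; ring.
  have -> : k = v * k * n + (k + l) * (u * k) by rewrite -[LHS]mul1r -uvE; ring.
  by apply: rpredD; apply: dvdz_mull.
have [w [e [ewE e12]]] : exists w e, u * c = 3 * w + e /\ (e = 1 \/ e = 2).
  exists ((u * c) %/ 3)%Z, ((u * c) %% 3)%Z; split; first by rewrite (mulrC 3) -divz_eq.
  by move: (u * c) uc3 => r r3; clear -r3; lia.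
have ulE : u * l = 1 - v * n - u * k by rewrite -uvE; ring.
rewrite nE in yU *; case: e12 => eE.
  apply: cyc_universal_metacyclic_iso m_gt0 (cyc_universal_mod _ _ yU).
    by apply/eqz_modP; exists w; rewrite ucE ewE eE PoszM; ring.
  apply/eqz_modP; exists (- v - w - 1).
  by rewrite ulE ucE ewE eE nE PoszS1 !PoszM; ring.
have {}yU := cyc_universal_inv (cyc_universal_rot yU).
apply: cyc_universal_metacyclic_iso m_gt0 (cyc_universal_mod _ _ yU).
  by apply/eqz_modP; exists (- w - 1); rewrite ucE ewE eE PoszM; ring.
apply/eqz_modP; exists (- v - 2 * w - 2).
by rewrite ulE ucE ewE eE nE PoszS1 !PoszM; ring.
Qed.

End ScalingToNormalForm.

Theorem corollary4 (n : nat) (n_gt0 : (0 < n)%N) (k l : int)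
    (nkl_coprime : gcdz (gcdz n k) l = 1)
    (condC : (3 * l = 0 %[mod n])%Z \/ (3 * k = 0 %[mod n])%Z
             \/ (3 * (l - k) = 0 %[mod n])%Z) :
  let condA : Prop := (n = 0 %[mod 3])%N /\ (k + l = 0 %[mod 3])%Z in
  let G := cyc_pres (word3 n_gt0 k l) in
  [/\ (~ condA /\ (k <> 0 %[mod n])%Z /\ (l <> 0 %[mod n])%Z
         /\ (k <> l %[mod n])%Z ->
       isomorphic G
         (Bgroup ((2 ^+ n - (-1) ^+ n) %/ 3)%Z 3 (2 ^+ ((2 * n) %/ 3)%N) 1)),
      ((k = 0 %[mod n])%Z \/ (l = 0 %[mod n])%Z \/ (k = l %[mod n])%Z ->
       isomorphic G (Zmod `|(2 ^+ n - (-1) ^+ n : int)|%N))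
    & (condA ->
       isomorphic G
         (free_product
            (free_product
               (Zmod `|((2 ^+ (n %/ 3)%N - (-1) ^+ (n %/ 3)%N) %/ 3)%Z|%N)
               Zgroup)
            Zgroup))].
Proof.
move=> condA G; have [x xU] := cyc_pres_universal n_gt0 k l.
have nkl : setwise_coprime n k l.
  by move=> d dn dk dl; rewrite -[1%Z]nkl_coprime !dvdz_gcd dn dk dl.
have nlk : setwise_coprime n l k by move=> d dn dl dk; exact: nkl.
have nlkk : setwise_coprime n (l - k) (- k).
  move=> d dn dlk; rewrite dvdzE abszN -dvdzE => dk; apply: nkl => //.
  by rewrite -[l](subrK k) rpredD.
have sub_eq0 : (l - k = 0 %[mod n])%Z <-> (k = l %[mod n])%Z.
  split=> /eqz_modP[q qE]; apply/eqz_modP; exists (- q); last by rewrite qE; ring.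
  by rewrite -{1}(subKr l k) qE; ring.
have condA3 : condA <-> (3 %| n)%N /\ (3 %| k + l)%Z.
  split=> -[n3 kl3]; split; [exact/eqP| |exact/eqP|].
    by apply/dvdz_mod0P; rewrite kl3 mod0z.
  by rewrite (dvdz_mod0P kl3) mod0z.
have rot3 : (3 %| l - k - k)%Z = (3 %| k + l)%Z.
  have -> : l - k - k = (k + l) - k * 3 by ring.
  by rewrite rpredBr // dvdz_mull.
have xU_inv := cyc_universal_inv xU; have xU_rot := cyc_universal_rot xU.
split.
- case=> notA [k0 [l0 kl0]]; have notA3 := notA; rewrite condA3 in notA3.
  case: condC => [l3|[k3|lk3]].
  + by apply: cyc_iso_metacyclic xU_inv _ l3 _ l0 => //; rewrite addrC.
  + exact: cyc_iso_metacyclic xU _ k3 _ k0.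
  + apply: cyc_iso_metacyclic xU_rot _ lk3 _ _ => //; last by rewrite sub_eq0.
    by rewrite rot3.
- case=> [k0|[l0|kl0]].
  + exact: cyc_iso_Zmod xU _ k0.
  + exact: cyc_iso_Zmod xU_inv _ l0.
  + by apply: cyc_iso_Zmod xU_rot _ _ => //; rewrite sub_eq0.
- case/condA3=> n3 kl3; case: condC => [l3|[k3|lk3]].
  + by apply: cyc_iso_free xU_inv _ l3 n3 _ => //; rewrite addrC.
  + exact: cyc_iso_free xU _ k3 n3 kl3.
  + by apply: cyc_iso_free xU_rot _ lk3 n3 _ => //; rewrite rot3.
Qed.
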